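(* Let $\varepsilon_0,\mu_0,\varepsilon,\mu_1,\mu_2,\omega,\Delta_t,\Delta_x>0$, and consider the FDTD model of a planar interface between two magnetics with relative permeabilities $\mu_1,\mu_2$ and common relative permittivity $\varepsilon$ described in the context, with numerical wavenumbers $\widetilde k_1,\widetilde k_2\in\mathbb{R}$, amplitude $E_0\neq0$ and coefficients $\widetilde r,\widetilde t\in\mathbb{C}$. Suppose that the interface conditions (a) (continuity of the tangential electric field at the interface node) and (b) (discrete Ampère law at the interface node) of the context hold. Then $$ e^{i\widetilde{k}_1\Delta_x/2}-\widetilde{r}\,e^{-i\widetilde{k}_1\Delta_x/2}=\eta_1\left(\frac{e^{-i\widetilde{k}_2\Delta_x/2}}{\eta_2}+i\,\Omega\varepsilon_0\varepsilon\Delta_x\right)\widetilde{t},\qquad \Omega=\frac{2}{\Delta_t}\sin\left(\frac{\omega\Delta_t}{2}\right). $$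
   Context: Constants: $c=1/\sqrt{\varepsilon_0\mu_0}$; Courant number $S_{\mathrm c}=c\Delta_t/\Delta_x$; for $j=1,2$ the medium $j$ has relative permittivity $\varepsilon$, relative permeability $\mu_j$, refractive index $n_{j}=\sqrt{\varepsilon\mu_j}$ and impedance $\eta_j=\sqrt{\mu_0/\varepsilon_0}\,\sqrt{\mu_j/\varepsilon}$. The numerical wavenumbers satisfy the Yee dispersion relation $\sin(\widetilde k_j\Delta_x/2)=\frac{n_j}{S_{\mathrm c}}\sin(\omega\Delta_t/2)$. Let $\xi\in\frac12\mathbb{Z}$ denote position in units of $\Delta_x$ relative to the interface ($\xi=0$; medium 1 is $\xi<0$, medium 2 is $\xi>0$) and $q\in\frac12\mathbb{Z}$ time in units of $\Delta_t$. The discrete fields are incident: $E^{(i)\,q}[\xi]=E_0e^{i(\omega q\Delta_t-\widetilde k_1\xi\Delta_x)}$, $H^{(i)\,q}[\xi]=-\frac{E_0}{\eta_1}e^{i(\omega q\Delta_t-\widetilde k_1\xi\Delta_x)}$; reflected: $E^{(r)\,q}[\xi]=\widetilde rE_0e^{i(\omega q\Delta_t+\widetilde k_1\xi\Delta_x)}$, $H^{(r)\,q}[\xi]=\widetilde r\frac{E_0}{\eta_1}e^{i(\omega q\Delta_t+\widetilde k_1\xi\Delta_x)}$; transmitted: $E^{(t)\,q}[\xi]=\widetilde tE_0e^{i(\omega q\Delta_t-\widetilde k_2\xi\Delta_x)}$, $H^{(t)\,q}[\xi]=-\widetilde t\frac{E_0}{\eta_2}e^{i(\omega q\Delta_t-\widetilde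 k_2\xi\Delta_x)}$. Magnetic interface model: the interface $\xi=0$ is an electric-field node of the Yee grid; the nearest magnetic nodes $\xi=-\frac12$ and $\xi=+\frac12$ lie strictly in media 1 and 2. Write $H^q[-\tfrac12]=H^{(i)\,q}[-\tfrac12]+H^{(r)\,q}[-\tfrac12]$ and $H^q[\tfrac12]=H^{(t)\,q}[\tfrac12]$. The interface conditions, for all $q$, are: (a) $E^{(i)\,q}[0]+E^{(r)\,q}[0]=E^{(t)\,q}[0]$, and $E^q[0]$ denotes this common value; (b) $\varepsilon_0\varepsilon\,\dfrac{E^{q+1/2}[0]-E^{q-1/2}[0]}{\Delta_t}=\dfrac{H^q[\frac12]-H^q[-\frac12]}{\Delta_x}$. *)

(* Defs.v *)
(* Stdlib reals, with Coquelicot for the complex numbers. *)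
From Stdlib Require Import Reals.
From Coquelicot Require Import Coquelicot.

Open Scope R_scope.
Open Scope C_scope.

(* [cis x] is e^{ix}; Coquelicot has no complex exponential. *)
Definition cis (x : R) : C := (cos x, sin x).

Definition light_speed (eps0 mu0 : R) : R := (1 / sqrt (eps0 * mu0))%R.

Definition courant (eps0 mu0 Dt Dx : R) : R :=
  (light_speed eps0 mu0 * Dt / Dx)%R.

Definition refractive_index (eps mu : R) : R := sqrt (eps * mu).

Definition impedance (eps0 mu0 eps mu : R) : R :=
  (sqrt (mu0 / eps0) * sqrt (mu / eps))%R.

Definition yee_dispersion (eps0 mu0 eps mu omega Dt Dx k : R) : Prop :=
  (sin (k * Dx / 2) =
   refractive_index eps mu / courant eps0 mu0 Dt Dx * sin (omega * Dt / 2))%R.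

Definition Omega (omega Dt : R) : R := (2 / Dt * sin (omega * Dt / 2))%R.

(* A field maps a time [q] (in units of Dt) and a position [xi] (in units of
   Dx, relative to the interface) to its complex value. The formulas make sense
   for all real arguments, but the interface conditions only involve
   half-integer ones. *)
Definition field := R -> R -> C.

Definition half_integer (q : R) : Prop := exists m : Z, q = (IZR m / 2)%R.

Definition E_inc (omega Dt Dx k1 : R) (E0 : C) : field := fun q xi =>
  E0 * cis (omega * q * Dt - k1 * xi * Dx).

Definition H_inc (omega Dt Dx k1 eta1 : R) (E0 : C) : field := fun q xi =>
  - (E0 / eta1) * cis (omega * q * Dt - k1 * xi * Dx).

Definition E_refl (omega Dt Dx k1 : R) (E0 r : C) : field := fun q xi =>
  r * E0 * cis (omega * q * Dt + k1 * xi * Dx).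

Definition H_refl (omega Dt Dx k1 eta1 : R) (E0 r : C) : field := fun q xi =>
  r * (E0 / eta1) * cis (omega * q * Dt + k1 * xi * Dx).

Definition E_trans (omega Dt Dx k2 : R) (E0 t : C) : field := fun q xi =>
  t * E0 * cis (omega * q * Dt - k2 * xi * Dx).

Definition H_trans (omega Dt Dx k2 eta2 : R) (E0 t : C) : field := fun q xi =>
  - (t * (E0 / eta2)) * cis (omega * q * Dt - k2 * xi * Dx).

Definition E_continuity (Ei Er Et : field) : Prop :=
  forall q : R, half_integer q -> Ei q 0%R + Er q 0%R = Et q 0%R.

(* [E q], [Hm q], [Hp q] are the total fields at the nodes 0, -1/2, 1/2. *)
Definition discrete_ampere (eps0 eps Dt Dx : R) (E Hm Hp : R -> C) : Prop :=
  forall q : R, half_integer q ->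
    RtoC (eps0 * eps) * ((E (q + 1 / 2)%R - E (q - 1 / 2)%R) / Dt) =
    (Hp q - Hm q) / Dx.

(* The field at the interface node is the common value in [E_continuity],
   here written as the sum of the fields on the side of medium 1. *)
Definition interface_ampere (eps0 eps Dt Dx : R) (Ei Er Hi Hr Ht : field)
    : Prop :=
  discrete_ampere eps0 eps Dt Dx
    (fun q => Ei q 0%R + Er q 0%R)
    (fun q => Hi q (- (1 / 2))%R + Hr q (- (1 / 2))%R)
    (fun q => Ht q (1 / 2)%R).

(* Main.v *)
Require Import Defs.
From Stdlib Require Import Reals.
From Coquelicot Require Import Coquelicot.

Open Scope R_scope.
Open Scope C_scope.

(** All fields share the time factor $e^{i\omega q\Delta_t}$, so the conditions at $q=0$ already
    carry the information. Continuity gives $1+\widetilde r=\widetilde t$, hence the interface field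
    is $\widetilde t E_0e^{i\omega q\Delta_t}$. By [cis_sub_cis_opp] its centred time difference
    quotient is $i\Omega\,\widetilde t E_0$. The discrete Ampère law equates
    $\varepsilon_0\varepsilon$ times this with the jump of $H$ across one cell, whose half-cell
    phases are the exponentials of the claim. Multiplying by $\eta_1\Delta_x/E_0$ and isolating the
    medium 1 terms gives the identity. *)

Lemma RtoC_pos_neq_0 (x : R) : (0 < x)%R -> RtoC x <> 0.
Proof. intros hx h; apply RtoC_inj in h; exact (Rgt_not_eq _ _ hx h). Qed.

Lemma cis0 : cis 0 = 1.
Proof. unfold cis; rewrite cos_0, sin_0; reflexivity. Qed.

(** With $x=\omega\Delta_t/2$ this produces the sine in $\Omega$ from the centred time
    difference. *)
Lemma cis_sub_cis_opp (x : R) : cis x - cis (- x) = 2 * Ci * sin x.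
Proof.
  unfold cis; rewrite cos_neg, sin_neg.
  apply injective_projections; simpl; ring.
Qed.

Lemma impedance_pos (eps0 mu0 eps mu : R) :
  (0 < eps0)%R -> (0 < mu0)%R -> (0 < eps)%R -> (0 < mu)%R ->
  (0 < impedance eps0 mu0 eps mu)%R.
Proof.
  intros; unfold impedance.
  apply Rmult_lt_0_compat; apply sqrt_lt_R0; apply Rdiv_lt_0_compat; assumption.
Qed.

Theorem theorem2
  (eps0 mu0 eps mu1 mu2 omega Dt Dx : R)
  (heps0 : (0 < eps0)%R) (hmu0 : (0 < mu0)%R) (heps : (0 < eps)%R)
  (hmu1 : (0 < mu1)%R) (hmu2 : (0 < mu2)%R) (homega : (0 < omega)%R)
  (hDt : (0 < Dt)%R) (hDx : (0 < Dx)%R)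
  (k1 k2 : R)
  (hk1 : yee_dispersion eps0 mu0 eps mu1 omega Dt Dx k1)
  (hk2 : yee_dispersion eps0 mu0 eps mu2 omega Dt Dx k2)
  (E0 r t : C) (hE0 : E0 <> RtoC 0)
  (eta1 eta2 : R)
  (heta1 : eta1 = impedance eps0 mu0 eps mu1)
  (heta2 : eta2 = impedance eps0 mu0 eps mu2)
  (hcont : E_continuity (E_inc omega Dt Dx k1 E0) (E_refl omega Dt Dx k1 E0 r)
             (E_trans omega Dt Dx k2 E0 t))
  (hampere : interface_ampere eps0 eps Dt Dx
               (E_inc omega Dt Dx k1 E0) (E_refl omega Dt Dx k1 E0 r)
               (H_inc omega Dt Dx k1 eta1 E0) (H_refl omega Dt Dx k1 eta1 E0 r)
               (H_trans omega Dt Dx k2 eta2 E0 t)) :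
  cis (k1 * Dx / 2) - r * cis (- (k1 * Dx / 2)) =
  RtoC eta1 *
    (cis (- (k2 * Dx / 2)) / RtoC eta2 +
     Ci * RtoC (Omega omega Dt * eps0 * eps * Dx)) * t.
Proof.
  assert (he1 : RtoC eta1 <> 0).
  { apply RtoC_pos_neq_0; rewrite heta1; apply impedance_pos; assumption. }
  assert (he2 : RtoC eta2 <> 0).
  { apply RtoC_pos_neq_0; rewrite heta2; apply impedance_pos; assumption. }
  assert (hx : RtoC Dx <> 0) by (apply RtoC_pos_neq_0; assumption).
  assert (ht : RtoC Dt <> 0) by (apply RtoC_pos_neq_0; assumption).
  assert (h0 : half_integer 0) by (exists 0%Z; simpl; field).
  specialize (hcont _ h0); specialize (hampere _ h0); clear h0.
  unfold E_inc, E_refl, E_trans, H_inc, H_refl, H_trans in *; cbv beta in *.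
  replace (omega * 0 * Dt - k1 * 0 * Dx)%R with 0%R in hcont by ring.
  replace (omega * 0 * Dt + k1 * 0 * Dx)%R with 0%R in hcont by ring.
  replace (omega * 0 * Dt - k2 * 0 * Dx)%R with 0%R in hcont by ring.
  rewrite cis0 in hcont.
  (* In the Ampère law at $q=0$, $E$ is sampled half a time step before and after, and $H$ half a
     cell to either side, so each phase is purely temporal or purely spatial. *)
  replace (omega * (0 + 1 / 2) * Dt - k1 * 0 * Dx)%R
    with (omega * Dt / 2)%R in hampere by field.
  replace (omega * (0 + 1 / 2) * Dt + k1 * 0 * Dx)%R
    with (omega * Dt / 2)%R in hampere by field.
  replace (omega * (0 - 1 / 2) * Dt - k1 * 0 * Dx)%R
    with (- (omega * Dt / 2))%R in hampere by field.
  replace (omega * (0 - 1 / 2) * Dt + k1 * 0 * Dx)%R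
    with (- (omega * Dt / 2))%R in hampere by field.
  replace (omega * 0 * Dt - k1 * - (1 / 2) * Dx)%R
    with (k1 * Dx / 2)%R in hampere by field.
  replace (omega * 0 * Dt + k1 * - (1 / 2) * Dx)%R
    with (- (k1 * Dx / 2))%R in hampere by field.
  replace (omega * 0 * Dt - k2 * (1 / 2) * Dx)%R
    with (- (k2 * Dx / 2))%R in hampere by field.
  assert (hr : t = 1 + r).
  (* This form exposes the right-hand side of [hcont]; the amplitude $E_0\neq0$ then cancels. *)
  { replace t with (t * E0 * 1 / E0) by (field; assumption).
    rewrite <- hcont; field; assumption. }
  pose proof (cis_sub_cis_opp (omega * Dt / 2)) as hsin.
  unfold Omega; rewrite !RtoC_mult, RtoC_div by (apply Rgt_not_eq; assumption).
  rewrite RtoC_mult in hampere.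
  (* Exponentials become atoms, leaving an identity of rational expressions for [field]. *)
  set (a := cis (omega * Dt / 2)) in *.
  set (b := cis (- (omega * Dt / 2))) in *.
  set (c := cis (k1 * Dx / 2)) in *.
  set (d := cis (- (k1 * Dx / 2))) in *.
  set (f := cis (- (k2 * Dx / 2))) in *.
  set (s := RtoC (sin (omega * Dt / 2))) in *.
  match type of hampere with ?L = ?R =>
    assert (hL : L = eps0 * eps * (t * E0 * (a - b) / Dt))
      by (rewrite hr; field; assumption)
  end.
  rewrite hL, hsin in hampere; clear hL.
  (* Here [R] is the jump of $H$ divided by $\Delta_x$. Adding the transmitted term [f / eta2 * t]
     to [Dx * R / E0] leaves $(c-\widetilde r d)/\eta_1$; replacing [R] by the electric side then
     yields the $\Omega$ term. *)
  match type of hampere with ?L = ?R =>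
    transitivity (eta1 * (f / eta2 * t + Dx * R / E0));
      [ field; repeat split; assumption
      | rewrite <- hampere; field; repeat split; assumption ]
  end.
Qed.
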